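(* Let $X$ be a Tychonoff space. Then the space $(MC(X),\tau_V^+)$ is Polish if and only if $X$ is compact and metrizable.
   Context: All topological spaces are assumed Hausdorff and non-empty. A set-valued map $F$ from $X$ to $\mathbb{R}$ is identified with its graph $F\subseteq X\times\mathbb{R}$, with $F(x)=\{y:(x,y)\in F\}$. $F$ is usc if for every $x\in X$ and every open $V\supseteq F(x)$ there is a neighborhood $U$ of $x$ with $F(x')\subseteq V$ for all $x'\in U$. $F$ is cusco if it is usc and $F(x)$ is non-empty, compact and convex for every $x\in X$; it is minimal cusco if it is cusco and every cusco map $G\subseteq F$ satisfies $G=F$. $MC(X)$ is the set of all minimal cusco maps $F\subseteq X\times\mathbb{R}$; it is contained in $CL(X\times\mathbb{R})$, the set of all non-empty closed subsets of $X\times\mathbb{R}$. The upper Vietoris topology $\tau_V^+$ on $MC(X)$ has as base the sets $W^+=\{F\in MC(X):F\subseteq W\}$, $W$ open in $X\times\mathbb{R}$. A topological space is Polish if it is second countable and completely metrizable. *)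

(* Defs.v *)
From HB Require Import structures.
From mathcomp Require Import all_boot all_order all_algebra.
From mathcomp Require Import all_classical all_reals all_analysis.

Set Implicit Arguments.
Unset Strict Implicit.
Unset Printing Implicit Defensive.

Import Order.TTheory GRing.Theory Num.Theory.
Import numFieldNormedType.Exports.

Local Open Scope classical_set_scope.
Local Open Scope ring_scope.

Definition tychonoff_space (X : topologicalType) : Prop :=
  hausdorff_space X /\ completely_regular_space X.

Section Metrizability.
Variables (R : realType) (T : topologicalType).
Implicit Type d : T -> T -> R.

Definition is_metric d : Prop :=
  [/\ forall x y, 0 <= d x y,
      forall x y, d x y = 0 <-> x = y,
      forall x y, d x y = d y x
    & forall x y z, d x z <= d x y + d y z].

Definition induces_topology d : Prop :=
  forall U : set T, open U <->
    forall x, U x -> exists2 e : R, 0 < e & [set y | d x y < e] `<=` U.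

Definition complete_metric d : Prop :=
  forall u : nat -> T,
    (forall e : R, 0 < e ->
       exists N, forall m n, (N <= m)%N -> (N <= n)%N -> d (u m) (u n) < e) ->
    exists l : T, forall e : R, 0 < e ->
      exists N, forall n, (N <= n)%N -> d (u n) l < e.

Definition metrizable : Prop :=
  exists d, is_metric d /\ induces_topology d.

Definition completely_metrizable : Prop :=
  exists d, [/\ is_metric d, induces_topology d & complete_metric d].

Definition polish_space : Prop :=
  @second_countable T /\ completely_metrizable.

End Metrizability.
Arguments metrizable : clear implicits.
Arguments completely_metrizable : clear implicits.
Arguments polish_space : clear implicits.

(* A set-valued map from X to R is its graph F : set (X * R), and its value
   F(x) is the section xsection F x. *)
Section Cusco.
Variables (R : realType) (X : topologicalType).
Implicit Types F G : set (X * R).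

Definition usc F : Prop :=
  forall (x : X) (V : set R), open V -> xsection F x `<=` V ->
    \forall x' \near x, xsection F x' `<=` V.

Definition cusco F : Prop :=
  usc F /\
  forall x : X, [/\ xsection F x !=set0, compact (xsection F x)
                  & convex_set (xsection F x : set R^o)].

Definition minimal_cusco F : Prop :=
  cusco F /\ forall G, cusco G -> G `<=` F -> G = F.

End Cusco.

Definition MC (R : realType) (X : topologicalType) : Type :=
  {F : set (X * R) | minimal_cusco F}.

(* MC R X carries the upper Vietoris topology, as its topologicalType
   structure. *)
Section UpperVietoris.
Variables (R : realType) (X : topologicalType).

HB.instance Definition _ := gen_eqMixin (MC R X).
HB.instance Definition _ := gen_choiceMixin (MC R X).

Definition upper_vietoris (W : set (X * R)) : set (MC R X) :=
  [set F | sval F `<=` W].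

Lemma upper_vietoris_cover : \bigcup_(W in open) upper_vietoris W = setT.
Proof. by apply/seteqP; split=> // F _; exists setT => //; exact: openT. Qed.

Lemma upper_vietoris_join (W1 W2 : set (X * R)) (F : MC R X) :
  open W1 -> open W2 -> upper_vietoris W1 F -> upper_vietoris W2 F ->
  exists W, [/\ open W, upper_vietoris W F
    & upper_vietoris W `<=` upper_vietoris W1 `&` upper_vietoris W2].
Proof.
move=> oW1 oW2 FW1 FW2; exists (W1 `&` W2); split.
- exact: openI.
- by move=> p Fp; split; [exact: FW1|exact: FW2].
- by move=> G GW; split=> p /GW [].
Qed.

HB.instance Definition _ := isBaseTopological.Build (MC R X)
  upper_vietoris_cover upper_vietoris_join.

End UpperVietoris.

(* Main.v *)
Require Import Defs.
From mathcomp Require Import all_boot all_order all_algebra.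
From mathcomp Require Import all_classical all_reals all_analysis.
From mathcomp Require Import ring lra.
Import Order.TTheory GRing.Theory Num.Theory.
Import numFieldNormedType.Exports.
Local Open Scope classical_set_scope.
Local Open Scope ring_scope.

(** Necessity uses only that MC(X) has a countable base, and only the graphs of
continuous functions, which are minimal cusco maps. Choosing a continuous function
in each basic open set that contains one gives a sequence that is dense, up to 1/2,
for uniform convergence; the sets where its members exceed 1/2 then form a countable
base of X by complete regularity, and the sequence itself provides a metric
([metrizable_of_second_countable_MC]). If X were not compact it would contain a
locally finite sequence of points, along which a diagonal argument contradicts the
existence of a countable base at the zero function ([not_locally_finite]).

For sufficiency, let X be compact and metrizable. Write F in MC(X) as the set of the
(x, y) with g(x) <= y <= f(x), with f upper and g lower semicontinuous. Minimality
says that f is the upper envelope of g and g the lower envelope of f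
([minimal_cusco_localizes] is the form of this that is used). Fix a countable family
of functions h on X that peak at all points at all scales, such as the
- k * d (., q). The numbers max (f + h) and max (- g + h) depend continuously on F,
and their continuity is where minimality enters ([top_height_cont]). They determine
the topology: a compactness argument shows that if F lies inside an open set then
so does every map whose numbers are close enough to those of F on finitely many h
([near_hull]). So MC(X) embeds in a countable power of the line, and it is second
countable and metrizable.

Completeness is more delicate, since a limit of such families of numbers still
defines a cusco map between two boundaries f and g, but these need not be
envelopes of each other. That they are is a G-delta condition: max (f + h) is the
supremum, over the h' of the family, of the lower bounds
max (h + h') - max (- g + h'), which involve only g, and symmetrically for g; each
statement that one of these bounds is within 1/n is open ([gap]). As a G-delta
subset of a Polish space is Polish ([trapped_polish]), it remains to see that these
conditions force the limit to be a minimal cusco map ([limit_minimal_cusco]). *)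

Set Implicit Arguments.
Unset Strict Implicit.

(** * Spaces with countably many real coordinates *)

Section TruncatedSup.
Variables (R : realType) (I : countType).
Implicit Types a b c : I -> R.

Definition weight (i : I) : R := (pickle i).+1%:R^-1.

(** Truncating each term by a weight tending to 0 along the enumeration of [I]
makes smallness of the supremum a condition on finitely many terms, as for the
product metric on a countable power of the line. *)
Definition tsup a : R := sup (range (fun i => Num.min (weight i) (a i))).

Lemma weight_gt0 i : 0 < weight i.
Proof. by rewrite invr_gt0 ltr0n. Qed.

Lemma weight_le1 i : weight i <= 1.
Proof. by rewrite invf_le1 ?ltr0n // ler1n. Qed.

Lemma weight_lt (e : R) i : 0 < e -> (Num.trunc e^-1 <= pickle i)%N ->
  weight i < e.
Proof.
move=> e0 ei; rewrite invf_plt ?posrE ?ltr0n //.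
by apply: lt_le_trans (truncnS_gt _) _; rewrite ler_nat ltnS.
Qed.

Lemma tsup_ub a i : Num.min (weight i) (a i) <= tsup a.
Proof.
apply: ub_le_sup; last by exists i.
by exists 1 => _ [j _ <-]; rewrite ge_min weight_le1.
Qed.

Lemma tsup_void a : ~ ([set: I] !=set0) -> tsup a = 0.
Proof.
move=> I0.
suff E0 : range (fun i => Num.min (weight i) (a i)) = set0 by rewrite /tsup E0 sup0.
by apply/seteqP; split=> // x [i _ _]; case: I0; exists i.
Qed.

Lemma tsup_le a (e : R) : 0 <= e ->
  (forall i, Num.min (weight i) (a i) <= e) -> tsup a <= e.
Proof.
move=> e0 ae; have [[i _]|I0] := pselect ([set: I] !=set0).
  apply: ge_sup; first by exists (Num.min (weight i) (a i)), i.
  by move=> _ [j _ <-].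
by rewrite tsup_void.
Qed.

Lemma tsup_ge0 a : (forall i, 0 <= a i) -> 0 <= tsup a.
Proof.
move=> a0; have [[i _]|I0] := pselect ([set: I] !=set0).
  by apply: le_trans (tsup_ub a i); rewrite le_min a0 ltW ?weight_gt0.
by rewrite tsup_void.
Qed.

Lemma tsupD a b c : (forall i, 0 <= a i) -> (forall i, 0 <= b i) ->
  (forall i, c i <= a i + b i) -> tsup c <= tsup a + tsup b.
Proof.
move=> a0 b0 cab; apply: tsup_le; first by rewrite addr_ge0 ?tsup_ge0.
move=> i; apply: le_trans (lerD (tsup_ub a i) (tsup_ub b i)).
have := cab i; have := a0 i; have := b0 i; have := weight_gt0 i.
by rewrite /Num.min; do ![case: ifP]; lra.
Qed.

Lemma tsup_small a i e : 0 <= e -> e <= weight i -> tsup a < e -> a i < e.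
Proof.
move=> e0 ei ae; have := le_lt_trans (tsup_ub a i) ae.
by rewrite gt_min ltNge ei.
Qed.

(** The indices of bounded rank are finitely many, so a filter condition may be
imposed on all of them at once. *)
Lemma near_pickle_lt T (F : set_system T) (P : I -> T -> Prop) n : Filter F ->
  (forall i, \forall t \near F, P i t) ->
  \forall t \near F, forall i, (pickle i < n)%N -> P i t.
Proof.
move=> FF FP; pose Q (k : 'I_n) t := forall i, pickle i = k -> P i t.
have : \forall t \near F, forall k, Q k t.
  apply: filter_forall => k.
  have [[i ik]|nk] := pselect (exists i : I, pickle i = k).
    apply: filterS (FP i) => t Pt j jk.
    by rewrite (pcan_inj (@pickleK I) (etrans jk (esym ik))).
  by apply: filterE => t i ik; case: nk; exists i.
by apply: filterS => t Qt i ilt; exact: (Qt (Ordinal ilt)).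
Qed.

Lemma near_tsup_le T (F : set_system T) (a : T -> I -> R) e : Filter F ->
  0 < e -> (forall i, \forall t \near F, a t i <= e) ->
  \forall t \near F, tsup (a t) <= e.
Proof.
move=> FF e0 Fa.
apply: filterS (near_pickle_lt (Num.trunc e^-1) FF Fa) => t at_le.
apply: tsup_le => [|i]; first exact: ltW.
have [/at_le aie|ki] := ltnP (pickle i) (Num.trunc e^-1).
  by rewrite ge_min aie orbT.
by rewrite ge_min ltW // weight_lt.
Qed.

End TruncatedSup.

Section Coordinates.
Variables (R : realType) (T : topologicalType) (I : countType).
Variable phi : I -> T -> R.
Hypothesis phi_cont : forall i, continuous (phi i).
(* The topology of [T] is the initial one: a filter converges as soon as all
   its coordinates do. *)
Hypothesis phi_top : forall (x : T) (F : set_system T), Filter F ->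
  (forall i, phi i @ F --> phi i x) -> F --> x.
Hypothesis phi_inj : forall x y, (forall i, phi i x = phi i y) -> x = y.

Definition coord_dist x y := tsup (fun i => `|phi i x - phi i y|).

Lemma coord_dist_metric : is_metric coord_dist.
Proof.
split=> [x y|x y|x y|x y z].
- exact: tsup_ge0.
- split=> [d0|->]; last first.
    apply/le_anti; rewrite tsup_ge0 // tsup_le // => i.
    by rewrite subrr normr0 ge_min lexx orbT.
  apply: phi_inj => i; have := tsup_ub (fun i => `|phi i x - phi i y|) i.
  rewrite -/(coord_dist x y) d0 ge_min leNgt weight_gt0 /= normr_le0.
  by rewrite subr_eq0 => /eqP.
- by congr (tsup _); apply/funext => i; rewrite distrC.
- by apply: tsupD => // i; exact: ler_distD.
Qed.

Lemma near_coord_dist x e : 0 < e -> \forall y \near x, coord_dist x y < e.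
Proof.
move=> e0; have e20 : 0 < e / 2 by rewrite divr_gt0.
suff : \forall y \near x, coord_dist x y <= e / 2.
  by apply: filterS => y /le_lt_trans; apply; lra.
apply: near_tsup_le => // i.
by have /cvgrPdist_le/(_ _ e20) := @phi_cont i x.
Qed.

Lemma coord_dist_cvg (F : set_system T) x : Filter F ->
  (forall e, 0 < e -> \forall y \near F, coord_dist x y < e) -> F --> x.
Proof.
move=> FF Fd; apply: phi_top => i; apply/cvgrPdist_lt => e e0.
have m0 : 0 < Num.min e (weight R i) by rewrite lt_min e0 weight_gt0.
apply: filterS (Fd _ m0) => y /(tsup_small (ltW m0)).
by move=> /(_ i); rewrite ge_min lexx orbT lt_min => /(_ isT)/andP[].
Qed.

Lemma coord_dist_topology : induces_topology coord_dist.
Proof.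
move=> U; split=> [oU x Ux|dU].
  pose F := filter_from [set e : R | 0 < e]
    (fun e => [set y | coord_dist x y < e]).
  have FF : Filter F.
    apply: filter_from_filter; first by exists 1; exact: ltr01.
    move=> e e' /= e0 e'0; exists (Num.min e e'); first by rewrite /= lt_min e0.
    by move=> y /=; rewrite lt_min => /andP[].
  have Fx : F --> x by apply: coord_dist_cvg => e e0; exists e.
  by have [e e0 eU] := Fx U (open_nbhs_nbhs (conj oU Ux)); exists e.
rewrite openE => x /dU[e e0 eU].
exact: filterS (near_coord_dist x e0).
Qed.

Lemma coord_metrizable : metrizable R T.
Proof.
exists coord_dist.
by split; [exact: coord_dist_metric|exact: coord_dist_topology].
Qed.

(** A Cauchy sequence for [coord_dist] has Cauchy, hence convergent, coordinates;
so completeness says that the image of [T] in the power of the line is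
sequentially closed. *)
Lemma coord_completely_metrizable :
  (forall u : nat -> T, (forall i, cvgn (fun n => phi i (u n))) ->
     exists l : T, u @ \oo --> l) ->
  completely_metrizable R T.
Proof.
move=> phi_complete; exists coord_dist.
split; [exact: coord_dist_metric|exact: coord_dist_topology|move=> u u_cauchy].
have [i|l ul] := phi_complete u; last first.
  exists l => e e0.
  have [N _ Nu] := ul _ (near_coord_dist l e0).
  by exists N => n Nn; have [_ _ -> _] := coord_dist_metric; exact: Nu.
apply/(@cauchy_cvgP R (fmap (fun n => phi i (u n)) \oo)).
apply: cauchy_exP.
move=> e e0.
have m0 : 0 < Num.min e (weight R i) by rewrite lt_min e0 weight_gt0.
have [N Nu] := u_cauchy _ m0; exists (phi i (u N)), N => // n /= Nn.
rewrite -ball_normE /=.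
have := tsup_small (ltW m0) _ (Nu _ _ (leqnn N) Nn) (i := i).
by rewrite ge_min lexx orbT lt_min => /(_ isT)/andP[].
Qed.

Definition box (s : seq (I * rat * rat)) : set T :=
  [set x | forall t, t \in s -> ratr t.1.2 < phi t.1.1 x < ratr t.2].

Lemma open_box s : open (box s).
Proof.
rewrite openE => x; elim: s => [|t s IH] xs; first by apply: filterE => y t.
have /IH nsx : box s x by move=> t' t's; apply: xs; rewrite inE t's orbT.
have /andP[lo hi] := xs t (mem_head _ _).
have nlo := @phi_cont t.1.1 x _ (lt_nbhsr lo).
have nhi := @phi_cont t.1.1 x _ (lt_nbhsl hi).
apply: filterS3 nsx nlo nhi => y sy /= ylo yhi t'.
by rewrite inE => /orP[/eqP->|]; [rewrite ylo yhi|exact: sy].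
Qed.

(** The finite intersections of coordinate conditions with rational bounds form a
base. Applying [phi_top] to the filter that they generate around a point avoids
describing the initial topology explicitly. *)
Lemma coord_second_countable : @second_countable T.
Proof.
exists (range box); first exact: sub_countable (card_image_le _ _) (countableP _).
split=> [_ [s _ <-]|x]; first exact: open_box.
set F := filter_from _ _.
have FF : Filter F.
  apply: filter_from_filter.
    by exists setT; split=> //; exists [::] => //; apply/seteqP; split.
  move=> _ _ [[s _ <-] sx] [[s' _ <-] s'x]; exists (box (s ++ s')).
    split; first by exists (s ++ s').
    by move=> t; rewrite mem_cat => /orP[]; [exact: sx|exact: s'x].
  by move=> y yss'; split=> t ts; apply: yss'; rewrite mem_cat ts ?orbT.
apply: phi_top => i; apply/cvgrPdist_lt => e e0.
have [a] : exists a : rat, ratr a \in `]phi i x - e, phi i x[.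
  by apply: rat_in_itvoo; lra.
have [b] : exists b : rat, ratr b \in `]phi i x, phi i x + e[.
  by apply: rat_in_itvoo; lra.
rewrite !in_itv /= => /andP[b1 b2] /andP[a1 a2].
exists (box [:: (i, a, b)]).
  split; first by exists [:: (i, a, b)].
  by move=> t; rewrite inE => /eqP-> /=; rewrite a2 b1.
move=> y /(_ _ (mem_head _ _)) /= /andP[ay yb].
by rewrite ltr_distlC; apply/andP; split; lra.
Qed.
End Coordinates.

Section Trapped.
Variables (R : realType) (T : topologicalType) (J : countType).
Variable w : J -> T -> R.
Hypothesis w_cont : forall j, continuous (w j).

(** A continuous substitute for the distance to the complement of the union of
the open sets [w j > 0]: positive exactly on that union. *)
Definition depth x := tsup (fun j => Num.max 0 (w j x)).

Lemma depth_cont : continuous depth.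
Proof.
move=> x; apply/cvgrPdist_le => e e0.
have : \forall y \near x, tsup (fun j => `|w j x - w j y|) <= e.
  by apply: near_tsup_le => // j; have /cvgrPdist_le/(_ _ e0) := @w_cont j x.
apply: filterS => y xy.
have depthD a b : depth a <= depth b + tsup (fun j => `|w j a - w j b|).
  apply: tsupD => j //; first by rewrite le_max lexx.
  rewrite ge_max; apply/andP; split.
    by rewrite addr_ge0 // le_max lexx.
  rewrite -lerBlDr le_max; apply/orP; right.
  by have := ler_norm (w j a - w j b); lra.
have := depthD x y; have := depthD y x.
under eq_fun do rewrite distrC.
by rewrite ler_norml; lra.
Qed.

Lemma depth_gt0 x j : 0 < w j x -> 0 < depth x.
Proof.
move=> wj; apply: lt_le_trans (tsup_ub _ j).
by rewrite lt_min weight_gt0 lt_max wj orbT.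
Qed.

(** A lower bound on the depth confines the point to the union of finitely many
of the open sets [w j > 0], uniformly in the point. *)
Lemma depth_bounded_index c : 0 < c ->
  exists n, forall x, c <= depth x -> exists2 j, (pickle j < n)%N & 0 < w j x.
Proof.
move=> c0; have c20 : 0 < c / 2 by lra.
exists (Num.trunc (c / 2)^-1) => x cx.
apply: contrapT => nj; suff : depth x <= c / 2 by lra.
apply: tsup_le => [|j]; first exact: ltW.
have [jn|nj'] := ltnP (pickle j) (Num.trunc (c / 2)^-1).
  rewrite ge_min; apply/orP; right; rewrite ge_max ltW //=.
  rewrite leNgt; apply/negP => cw; apply: nj; exists j => //.
  exact: lt_trans cw.
by rewrite ge_min ltW // weight_lt.
Qed.

End Trapped.

(** A G-delta subset of a Polish space is Polish. Here the coordinates [phi]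
embed [T] in a power of the line and the open sets are, for each [k], the union
of the [w k j > 0] over [j]. Adding the inverses of the depths to the coordinates
changes neither continuity nor the topology, but a sequence along which they all
converge stays, for each [k], in the union of finitely many of the [w k j > 0]; it
is thus enough to find limits for such trapped sequences. *)
Lemma trapped_polish (R : realType) (T : topologicalType) (I J K : countType)
    (phi : I -> T -> R) (w : K -> J -> T -> R) :
  (forall i, continuous (phi i)) ->
  (forall (x : T) (F : set_system T), Filter F ->
    (forall i, phi i @ F --> phi i x) -> F --> x) ->
  (forall x y, (forall i, phi i x = phi i y) -> x = y) ->
  (forall k j, continuous (w k j)) ->
  (forall k x, exists j, 0 < w k j x) ->
  (forall u : nat -> T, (forall i, cvgn (fun n => phi i (u n))) ->
    (forall k, exists n, forall m,
       exists2 j, (pickle j < n)%N & 0 < w k j (u m)) ->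
    exists l : T, u @ \oo --> l) ->
  polish_space R T.
Proof.
move=> phi_cont phi_top phi_inj w_cont w_cover complete.
pose psi (i : I + K) x :=
  match i with inl i => phi i x | inr k => (depth (w k) x)^-1 end.
have dgt0 k x : 0 < depth (w k) x by have [j /depth_gt0] := w_cover k x.
split; first exact: (coord_second_countable phi_cont phi_top).
apply: (@coord_completely_metrizable _ _ _ psi).
- case=> [i|k] x /=; first exact: phi_cont.
  by apply: cvgV; [rewrite gt_eqF|exact: depth_cont].
- by move=> x F FF psi_cvg; apply: phi_top => i; exact: (psi_cvg (inl i)).
- by move=> x y xy; apply: phi_inj => i; exact: (xy (inl i)).
- move=> u u_cvg; apply: complete => [i|k]; first exact: (u_cvg (inl i)).
  have [M [_ Mu]] := cvg_seq_bounded (u_cvg (inr k)).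
  pose c := (`|M| + 1)^-1.
  have M0 : 0 < `|M| + 1 by have := normr_ge0 M; lra.
  have c0 : 0 < c by rewrite invr_gt0.
  have [n nP] := depth_bounded_index (w k) c0.
  exists n => m; apply: nP; rewrite /c -[leRHS]invrK lef_pV2 ?posrE ?invr_gt0 //.
  have -> : (depth (w k) (u m))^-1 = `|psi (inr k) (u m)|.
    by rewrite ger0_norm //= invr_ge0 ltW.
  by apply: Mu => //; have := ler_norm M; lra.
Qed.

(** * Neighbourhoods in MC(X) and graphs of continuous functions *)

Lemma open_upper_vietoris (R : realType) (X : topologicalType) (W : set (X * R)) :
  open W -> open (@upper_vietoris R X W).
Proof. by move=> oW; exists [set W]; [move=> _ ->|rewrite bigcup_set1]. Qed.

(** The sets of the members below an open [W] are stable under intersection, so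
a single [W] suffices to describe a neighbourhood. *)
Lemma nbhs_upper_vietoris (R : realType) (X : topologicalType) (F : MC R X) U :
  nbhs F U <-> exists W,
    [/\ open W, sval F `<=` W & @upper_vietoris R X W `<=` U].
Proof.
split.
  rewrite nbhsE => -[V [oV FV] VU]; move: oV FV VU => [D Dop <-] [W DW FW] VU.
  by exists W; split => //; [exact: Dop|move=> G GW; apply: VU; exists W].
move=> [W [oW FW WU]]; rewrite nbhsE; exists (upper_vietoris W) => //.
by split => //; exact: open_upper_vietoris.
Qed.

Section Graph.
Variables (R : realType) (X : topologicalType).
Implicit Types (f : X -> R) (F : set (X * R)).

Definition graph f : set (X * R) := [set p | p.2 = f p.1].

Lemma xsection_graph f x : xsection (graph f) x = [set f x].
Proof. by apply/seteqP; split=> y; rewrite /xsection /= inE. Qed.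

(** Continuity is upper semicontinuity here, and a cusco map inside a graph has
non-empty values inside singletons. *)
Lemma graph_minimal_cusco f : continuous f -> minimal_cusco (graph f).
Proof.
move=> cf; split.
  split=> [x V oV|x]; rewrite xsection_graph.
    move=> /(_ _ erefl) Vfx.
    have : \forall x' \near x, V (f x') :=
      cf x _ (open_nbhs_nbhs (conj oV Vfx)).
    by apply: filterS => x' Vfx'; rewrite xsection_graph => _ ->.
  split; [by exists (f x)|exact: compact_set1|].
  by move=> y z t; rewrite !inE => -> ->; rewrite convmm.
move=> G [_ G_cusco] Gf; apply/seteqP; split => // -[x z]; rewrite /graph /= => ->.
have [[y]] := G_cusco x; rewrite /xsection /= inE => Gxy _ _.
by rewrite -[f x](Gf _ Gxy).
Qed.

Definition graph_MC f (cf : continuous f) : MC R X :=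
  exist _ _ (graph_minimal_cusco cf).

Lemma open_graph_band f e : continuous f ->
  open [set p : X * R | `|p.2 - f p.1| < e].
Proof.
move=> cf; have cg : continuous (fun p : X * R => `|p.2 - f p.1|).
  move=> p; apply: cvg_norm; apply: cvgB; first exact: cvg_snd.
  by apply: continuous_cvg; [exact: cf|exact: cvg_fst].
exact: (open_comp (fun p _ => cg p) (@open_lt _ e)).
Qed.

Lemma completely_regular_bump x U : completely_regular_space X ->
  open U -> U x -> exists f, [/\ continuous f, f x = 1,
    (forall y, 0 <= f y <= 1) & (forall y, ~ U y -> f y = 0)].
Proof.
move=> crX oU Ux; have [|f [cf f01 fx fU]] :=
  (@uniform_separatorP _ R [set x] (~` U)).1.
  by apply: crX; [exact: open_closedC|exact].
exists (fun y => 1 - f y); split.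
- by move=> y; apply: cvgB; [exact: cvg_cst|exact: cf].
- by have -> : f x = 0; [apply: fx; exists x|rewrite subr0].
- move=> y; have /= := f01 (f y); rewrite in_itv /=.
  move=> /(_ (ex_intro2 _ _ y I erefl)).
  by move=> /andP[? ?]; apply/andP; split; lra.
- by move=> y nUy; have -> : f y = 1; [apply: fU; exists y|rewrite subrr].
Qed.

Lemma open_over_point (x : X) (V : set R) : hausdorff_space X -> open V ->
  open [set p : X * R | p.1 = x -> V p.2].
Proof.
move=> hX oV.
have oCx : open (~` [set x]).
  exact/closed_openC/accessible_closed_set1/hausdorff_accessible.
have -> : [set p : X * R | p.1 = x -> V p.2] =
    [set p : X * R | (~` [set x]) p.1] `|` [set p : X * R | V p.2].
  apply/seteqP; split=> [p /= pV|p [px /px//|Vp _]]; last exact: Vp.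
  by have [/pV|] := pselect (p.1 = x); [right|left].
apply: openU; first by apply: open_comp oCx => p _; exact: cvg_fst.
by apply: open_comp oV => p _; exact: cvg_snd.
Qed.

End Graph.

(** * Second countability of MC(X) forces compactness and metrizability *)

Section Necessity.
Variables (R : realType) (X : topologicalType).
Hypothesis hX : hausdorff_space X.
Hypothesis crX : completely_regular_space X.
Hypothesis sc : @second_countable (MC R X).

(** Numbering a countable base; the numbers that are not attained get the empty
set. *)
Lemma countable_nbhs_base : exists b : nat -> set (MC R X),
  forall (F : MC R X) U, nbhs F U -> exists n, nbhs F (b n) /\ b n `<=` U.
Proof.
have [B /countable_injP[c c_inj] [Bo Bb]] := sc.
exists (fun n => \bigcup_(V in [set V | B V /\ c V = n]) V) => F U FU.
have [V [BV VF] VU] := Bb F U FU; exists (c V).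
have -> : \bigcup_(V' in [set V' | B V' /\ c V' = c V]) V' = V.
  apply/seteqP; split=> [G [V' [BV' cV'] V'G]|G VG]; last by exists V.
  by rewrite -(c_inj V' V) ?inE.
by split => //; apply: open_nbhs_nbhs; split => //; exact: Bo.
Qed.

(** The open set of the members within 1/2 of the graph of [g] contains a basic
neighbourhood of that graph, hence the continuous function chosen for it. *)
Lemma uniformly_dense_sequence : exists f : nat -> X -> R,
  (forall n, continuous (f n)) /\
  forall g : X -> R, continuous g -> exists n, forall x, `|f n x - g x| < 2^-1.
Proof.
have [b b_base] := countable_nbhs_base.
have /choice[f fP] : forall n, exists f : X -> R, continuous f /\
    ((exists G : MC R X, b n G /\ exists2 g, continuous g & sval G = graph g) ->
     exists G : MC R X, b n G /\ sval G = graph f).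
  move=> n; have [[G [bG [g cg Gg]]]|nG] := pselect
    (exists G : MC R X, b n G /\ exists2 g, continuous g & sval G = graph g).
    by exists g; split => // _; exists G.
  by exists (fun=> 0); split => // x; exact: cvg_cst.
exists f; split=> [n|g cg]; first by have [] := fP n.
pose W := [set p : X * R | `|p.2 - g p.1| < 2^-1].
have [n [ngn bW]] : exists n,
    nbhs (graph_MC cg) (b n) /\ b n `<=` @upper_vietoris R X W.
  apply: b_base; apply/nbhs_upper_vietoris; exists W; split => //.
    exact: open_graph_band.
  by move=> -[x y] xy; have {xy}-> : y = g x := xy; rewrite /W /= subrr normr0.
exists n => x; have [_ []] := fP n.
  exists (graph_MC cg); split; first exact: nbhs_singleton ngn.
  by exists g.
by move=> G [/bW GW Gf]; apply: (GW (x, f n x)); rewrite Gf.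
Qed.

(** The sets [f n > 1/2] form a countable base of [X]: approximate within 1/2 a
bump function equal to 1 at the point and to 0 off its neighbourhood. *)
Lemma countable_separating_family : exists f : nat -> X -> R,
  (forall n, continuous (f n)) /\
  forall x U, nbhs x U -> exists n, 2^-1 < f n x /\ forall y, 2^-1 < f n y -> U y.
Proof.
have [f [cf f_dense]] := uniformly_dense_sequence.
exists f; split => // x U; rewrite nbhsE => -[V [oV Vx] VU].
have [g [cg gx1 g01 g0]] := completely_regular_bump R crX oV Vx.
have [n fg] := f_dense g cg; exists n; split.
  by have := fg x; rewrite gx1 ltr_distl => /andP[]; lra.
move=> y fy; apply: VU; apply: contrapT => /g0 gy.
by have := fg y; rewrite gy ltr_distl => /andP[]; lra.
Qed.

Lemma metrizable_of_second_countable_MC : metrizable R X.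
Proof.
have [f [cf f_sep]] := countable_separating_family.
apply: (@coord_metrizable _ _ _ f) => // [x F FF fF U|x y fxy].
  move=> /f_sep[n [fx fU]].
  have : \forall y \near F, 2^-1 < f n y := fF n _ (lt_nbhsr fx).
  exact: filterS.
apply: hX => A B xA yB; have [n [fx fA]] := f_sep x A xA.
exists y; split; last exact: nbhs_singleton.
by apply: fA; rewrite -fxy.
Qed.

(** A diagonal argument. Given a locally finite sequence of points, choose in
the [n]-th basic neighbourhood of the zero function a continuous function not
vanishing at the [n]-th point. The points of these graphs above the sequence form
a closed set missed by the zero function, and the complement of this closed set
defines a neighbourhood of the zero function containing no basic one. *)
Lemma not_locally_finite (x : nat -> X) :
  ~ (forall a : X, exists2 U : set X, nbhs a U &
       exists N, forall n, (N <= n)%N -> ~ U (x n)).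
Proof.
move=> x_lf; have [b b_base] := countable_nbhs_base.
have c0 : continuous (fun _ : X => 0 : R) by move=> ?; exact: cvg_cst.
have /choice[f fP] : forall n, exists f : X -> R, [/\ continuous f, f (x n) != 0 &
    (nbhs (graph_MC c0) (b n) ->
     exists2 G : MC R X, b n G & sval G = graph f)].
  move=> n; have [|nb] := pselect (nbhs (graph_MC c0) (b n)); last first.
    by exists (fun=> 1); split => //; move=> ?; exact: cvg_cst.
  move=> /nbhs_upper_vietoris[W [oW W0 Wb]].
  have : nbhs (x n, 0 : R) W by apply: open_nbhs_nbhs; split => //; exact: W0.
  move=> [[A B] /= [xA /nbhs_ballP[e /= e0 eB]] ABW].
  have : nbhs (x n) (interior A) by exact: nbhs_interior.
  have [//||g [cg gx g01 gA]] :=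
    @completely_regular_bump R X (x n) (interior A) crX.
  - exact: open_interior.
  - exact: xA.
  move=> _; have cf : continuous (fun y => e / 2 * g y).
    by move=> y; apply: cvgM; [exact: cvg_cst|exact: cg].
  exists (fun y => e / 2 * g y); split => //.
    by rewrite gx mulr1 gt_eqF // divr_gt0.
  move=> _; exists (graph_MC cf) => //; apply: Wb => -[a z] az.
  have {az}-> : z = e / 2 * g a := az.
  have [Aa|/gA ->] := pselect (interior A a); last by rewrite mulr0; exact: W0.
  apply: ABW; split; first exact: interior_subset.
  apply: eB; rewrite -ball_normE /= sub0r normrN ger0_norm.
    by have /andP[_ ga1] := g01 a; nra.
  by have /andP[ga0 _] := g01 a; nra.
pose V := [set p : X * R | forall n, p <> (x n, f n (x n))].
have oV : open V.
  rewrite openE => p Vp; have [U aU [N xU]] := x_lf p.1.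
  have nU : nbhs p [set p | U p.1] by exact: (cvg_fst aU).
  pose P (k : 'I_N) := [set p : X * R | p.1 = x k -> p.2 != f k (x k)].
  have nP : \forall q \near nbhs p, forall k, P k q.
    apply: filter_forall => k; apply: open_nbhs_nbhs; split.
      by apply: (open_over_point (V := [set z | z != f k (x k)])).
    move=> /= pk; apply/eqP => yk; apply: (Vp k).
    by move: pk yk; case: (p) => ? ? /= -> ->.
  apply: filterS2 nU nP => -[a' y'] /= Ua' a'y' n [a'x y'x].
  have [nN|/xU] := ltnP n N; last by rewrite -a'x.
  by have /eqP := a'y' (Ordinal nN) a'x.
have [n [n0 nV]] : exists n,
    nbhs (graph_MC c0) (b n) /\ b n `<=` @upper_vietoris R X V.
  apply: b_base; apply/nbhs_upper_vietoris; exists V; split => // -[a z] az n.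
  have {az}-> : z = 0 := az; move=> [_ fxn].
  by have [_] := fP n; rewrite -fxn eqxx.
have [_ _ /(_ n0)[G /nV GV Gf]] := fP n.
have : V (x n, f n (x n)) by apply: GV; rewrite Gf.
by move=> /(_ n).
Qed.

(** A filter without cluster point contains the complements of basic open sets
that cover the space; points taken outside more and more of them form a locally
finite sequence. *)
Lemma compact_of_second_countable_MC : compact [set: X].
Proof.
have [f [cf f_sep]] := countable_separating_family.
move=> F FF _; apply: contrapT => noF.
pose U n := [set y | 2^-1 < f n y].
have good a : exists n, U n a /\ F (~` U n).
  apply: contrapT => na; apply: noF; exists a; split => // A B FA aB.
  apply: contrapT => AB; have [n [fa fB]] := f_sep a B aB.
  apply: na; exists n; split => //; apply: filterS FA => y Ay /fB By.
  by apply: AB; exists y.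
have /choice[x xP] : forall m, exists y,
    forall n, (n < m)%N -> F (~` U n) -> ~ U n y.
  move=> m; apply: (@filter_ex _ F).
  have : \forall y \near F, forall k : 'I_m, F (~` U k) -> ~ U k y.
    apply: filter_forall => k; have [Fk|nFk] := pselect (F (~` U k)).
      by apply: filterS Fk.
    by apply: filterE => y /nFk.
  by apply: filterS => y yP n nm; exact: (yP (Ordinal nm)).
apply: (@not_locally_finite x) => a; have [n [Una FUn]] := good a.
exists (U n); first by exact: (cf n a _ (lt_nbhsr Una)).
by exists n.+1 => m nm; exact: xP.
Qed.

End Necessity.

(** * Cusco maps and minimality *)

Section Flip.
Variable R : realType.

(** The sign lets a single argument treat the upper and the lower boundaries of a
map with interval values. *)
Definition flip (s : bool) (y : R) := if s then y else - y.

Lemma flip_cont s : continuous (flip s).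
Proof. by case: s => y /=; [exact: cvg_id|apply: cvgN; exact: cvg_id]. Qed.

Lemma ler_flip s y : flip s y <= `|y|.
Proof. by case: s => /=; rewrite ?ler_norm // -normrN ler_norm. Qed.

Lemma convex_between (A : set R) a b y : convex_set (A : set R^o) ->
  A a -> A b -> a <= y <= b -> A y.
Proof.
move=> cA Aa Ab /andP[ay yb]; have [ab|ba] := ltP a b; last first.
  by have -> : y = a by lra.
have t0 : 0 <= (b - y) / (b - a) by apply: divr_ge0; lra.
have t1 : (b - y) / (b - a) <= 1 by rewrite ler_pdivrMr; lra.
have := cA a b (Itv01 t0 t1); rewrite !inE => /(_ Aa Ab).
rewrite [X in A X](_ : _ = y) //.
have ba0 : b - a != 0 by rewrite subr_eq0 gt_eqF.
transitivity ((b - y) / (b - a) * a + (1 - (b - y) / (b - a)) * b) => //.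
by field.
Qed.

Lemma flip_conv_le s (a b : convex_lmodType R^o) (t : {i01 R}) c :
  flip s a <= c -> flip s b <= c -> flip s (conv t a b) <= c.
Proof.
have t0 : 0 <= t%:num by [].
have t1 : t%:num <= 1 by [].
have -> : conv t a b = t%:num * a + (1 - t%:num) * b by [].
by case: s => /=; nra.
Qed.

Lemma convex_separation (A : set R) y : convex_set (A : set R^o) -> ~ A y ->
  exists s, forall z, A z -> flip s z < flip s y.
Proof.
move=> cA nAy; apply: contrapT => /forallNP ns.
have above s : exists2 z, A z & flip s y <= flip s z.
  apply: contrapT => nz; apply: (ns s) => z Az; rewrite ltNge; apply/negP => yz.
  by apply: nz; exists z.
have [b Ab yb] := above true; have [a Aa ya] := above false.
by apply: nAy; apply: (convex_between cA Aa Ab); rewrite /flip in yb ya; lra.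
Qed.

(** The values of [flip s] on a compact set have a maximum; the gap below [c] is
obtained directly from near covering, letting [c'] tend to [c] from below. *)
Lemma compact_strict_bound (A : set R) s c : compact A ->
  (forall y, A y -> flip s y < c) ->
  exists2 c', c' < c & forall y, A y -> flip s y < c'.
Proof.
move=> /compact_near_coveringP cA Ac.
have nA : \forall c' \near c^'-, A `<=` fun y => flip s y < c'.
  apply: cA => y /Ac yc.
  exists ([set y' | flip s y' < (flip s y + c) / 2],
          [set c' | (flip s y + c) / 2 < c']).
    split => /=; last by apply: nbhs_left_gt; lra.
    by apply: (@flip_cont s y [set z | z < _]); apply: lt_nbhsl; lra.
  by move=> [y' c'] /= []; exact: lt_trans.
have lt_c : \forall c' \near c^'-, c' < c by exact: nbhs_left_lt.
have [c' [Ac' c'c]] := filter_ex (filterI nA lt_c).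
by exists c' => // y /Ac'.
Qed.

End Flip.

Section Cusco.
Variables (R : realType) (X : topologicalType).
Implicit Types F G : set (X * R).

Lemma usc_near F x (V : set R) : usc F -> open V -> (forall y, F (x, y) -> V y) ->
  \forall x' \near x, forall y, F (x', y) -> V y.
Proof.
move=> uF oV FV; have : xsection F x `<=` V by move=> y /xsectionP/FV.
by move=> /(uF _ _ oV); apply: filterS => x' FV' y /xsectionP/FV'.
Qed.

Lemma cusco_bounded F : compact [set: X] -> cusco F ->
  exists c, forall p, F p -> `|p.2| <= c.
Proof.
move=> /compact_near_coveringP cX [uF Fx].
have nF : \forall c \near +oo%R,
    [set: X] `<=` fun x => forall y, F (x, y) -> `|y| <= c.
  apply: cX => x _; have [_ cFx _] := Fx x.
  have [M [_ FM]] := compact_bounded cFx.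
  pose c := `|M| + 1.
  have nx : \forall x' \near x, forall y, F (x', y) -> `|y| < c + 1.
    apply: (@usc_near F x [set y | `|y| < c + 1]) => //.
      apply: (@open_comp R R Num.norm [set z | z < c + 1]); last exact: open_lt.
      by move=> ? _; exact: norm_continuous.
    move=> y /xsectionP Fy /=; have := FM c _ y Fy; rewrite /c; have := ler_norm M.
    by move=> h /(_ _)/le_lt_trans; apply; lra.
  exists ([set x' | forall y, F (x', y) -> `|y| < c + 1],
          [set c' | c + 1 < c']).
    by split => //=; apply: nbhs_pinfty_gt; rewrite num_real.
  by move=> [x' c'] /= [Fx' cc'] y /Fx'/ltW/le_trans; apply; exact: ltW.
have [c Fc] := filter_ex nF.
by exists c => -[x y] Fxy; exact: (Fc x I y).
Qed.

(** Minimality enters only here: if every point of an open [U] had a value at most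
[c], cutting the values over [U] down to those at most [c] would give a strictly
smaller cusco map. So a large value of a minimal map is approached by points
where all the values are large. *)
Lemma minimal_cusco_localizes F s x y (V : set X) c : minimal_cusco F ->
  F (x, y) -> nbhs x V -> c < flip s y ->
  exists2 x', V x' & forall y', F (x', y') -> c < flip s y'.
Proof.
move=> [[uF Fx] Fmin] Fxy; rewrite nbhsE => -[U [oU Ux] UV] cy.
apply: contrapT => nx'.
have low x' : U x' -> exists2 y', F (x', y') & flip s y' <= c.
  move=> Ux'; apply: contrapT => ny'; apply: nx'; exists x'; first exact: UV.
  move=> y' Fy'; rewrite ltNge; apply/negP => y'c; apply: ny'.
  by exists y'.
pose C x' : set R := [set y' | U x' -> flip s y' <= c].
pose G := [set p | F p /\ C p.1 p.2].
have GF : G `<=` F by move=> p [].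
suff : cusco G.
  move=> /Fmin/(_ GF) GeF; move: Fxy; rewrite -GeF => -[_ /(_ Ux)].
  by rewrite leNgt cy.
have Gx x' : xsection G x' = xsection F x' `&` C x'.
  apply/seteqP; split=> y'.
    by move=> /xsectionP[Fy' Cy']; split=> //; apply/xsectionP.
  by move=> [/xsectionP Fy Cy]; rewrite /xsection /= inE; split.
have Cclosed x' : closed (C x').
  have [Ux'|nUx'] := pselect (U x'); last first.
    rewrite (_ : C x' = setT); first exact: closedT.
    by apply/seteqP; split=> // y' _ /nUx'.
  rewrite (_ : C x' = flip s @^-1` [set z | z <= c]); last first.
    by apply/seteqP; split=> [y' /(_ Ux')|y' ? _].
  by apply: closed_comp; [move=> ? _; exact: flip_cont|exact: closed_le].
split=> [x' V' oV'|x']; rewrite Gx.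
  move=> GV'; have [Ux'|nUx'] := pselect (U x').
    have : \forall x'' \near x', forall y', F (x'', y') ->
        (V' `|` flip s @^-1` [set z | c < z]) y'.
      apply: usc_near => //.
        apply: openU => //; apply: open_comp; last exact: open_gt.
        by move=> ? _; exact: flip_cont.
      move=> y' Fy'; have [cy'|y'c] := ltP c (flip s y'); [by right|left].
      by apply: GV'; split => //; apply/xsectionP.
    apply: filterS2 (open_nbhs_nbhs (conj oU Ux')) => x'' Ux'' Fx''.
    rewrite Gx => y' [/xsectionP/Fx''[//|/= cy'] /(_ Ux'')].
    by rewrite leNgt cy'.
  have : \forall x'' \near x', forall y', F (x'', y') -> V' y'.
    by apply: usc_near => // y' Fy'; apply: GV'; split => //; apply/xsectionP.
  by apply: filterS => x'' Fx''; rewrite Gx => y' [/xsectionP/Fx''].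
have [ne cpt cvx] := Fx x'; split.
- have [/low[y' Fy' y'c]|nUx'] := pselect (U x').
    by exists y'; split => //; apply/xsectionP.
  by have [y' Fy'] := ne; exists y'; split.
- exact: compact_closedI.
- move=> a b t; rewrite !inE => -[Fa Ca] [Fb Cb]; split.
    by have := cvx a b t; rewrite !inE; apply.
  by move=> Ux'; exact: flip_conv_le (Ca Ux') (Cb Ux').
Qed.

End Cusco.

(** * Coordinates on MC(X) *)

Section TopHeights.
Variables (R : realType) (X : topologicalType) (J : countType) (h : J -> X -> R).
Variables (x0 : X) (j0 : J).
Hypothesis hX : hausdorff_space X.
Hypothesis cX : compact [set: X].
Hypothesis h_cont : forall j, continuous (h j).
Hypothesis h_le0 : forall j x, h j x <= 0.
Hypothesis h_j0 : forall x, h j0 x = 0.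
(* Peaking functions: nearly 0 at a given point, very negative off a given
   neighbourhood of it. *)
Hypothesis h_peak : forall x U (B eta : R), nbhs x U -> 0 < eta ->
  exists j, - eta < h j x /\ forall x', ~ U x' -> h j x' < B.
Implicit Types (F G : set (X * R)) (pi : bool -> J -> R) (s : bool) (j : J).

Definition height s j (p : X * R) := flip s p.2 + h j p.1.

(** If f and g are the upper and lower boundaries of [F], this is the maximum of
f + h j when [s] is true, and that of - g + h j otherwise. *)
Definition top_height s j F := sup [set height s j p | p in F].

Definition hull pi : set (X * R) := [set p | forall s j, height s j p <= pi s j].

Lemma height_cont s j : continuous (height s j).
Proof.
move=> p; apply: cvgD.
  by apply: continuous_cvg; [exact: flip_cont|exact: cvg_snd].
by apply: continuous_cvg; [exact: h_cont|exact: cvg_fst].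
Qed.

Lemma height_le_top s j F p : cusco F -> F p -> height s j p <= top_height s j F.
Proof.
move=> cF Fp; have [c Fc] := cusco_bounded cX cF.
apply: ub_le_sup; last by exists p.
exists c => _ [q Fq <-]; have := ler_flip s q.2; have := h_le0 j q.1.
by have := Fc q Fq; rewrite /height; lra.
Qed.

Lemma cusco_nonempty F x : cusco F -> exists y, F (x, y).
Proof. by move=> [_ /(_ x)[[y /xsectionP Fy] _ _]]; exists y. Qed.

Lemma top_height_le s j F c : cusco F -> (forall p, F p -> height s j p <= c) ->
  top_height s j F <= c.
Proof.
move=> cF Fc; apply: ge_sup; last by move=> _ [p Fp <-]; exact: Fc.
by have [y Fy] := cusco_nonempty x0 cF; exists (height s j (x0, y)), (x0, y).
Qed.

Lemma top_height_gt s j F c : cusco F -> c < top_height s j F ->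
  exists2 p, F p & c < height s j p.
Proof.
move=> cF cS; apply: contrapT => np; move: cS; apply/negP; rewrite -leNgt.
apply: top_height_le => // p Fp; rewrite leNgt; apply/negP => cp; apply: np.
by exists p.
Qed.

(** A bound on the values at a single point is detected by a [top_height]: a
function peaking at that point makes the values far from it irrelevant, and those
near it are controlled by upper semicontinuity. *)
Lemma peak_top_height F s x c : cusco F -> (forall y, F (x, y) -> flip s y < c) ->
  exists j, top_height s j F < c + h j x.
Proof.
move=> cF Fxc; have [uF /(_ x)[_ cFx _]] := cF.
have [|c' c'c Fxc'] := @compact_strict_bound R (xsection F x) s c cFx.
  by move=> y /xsectionP/Fxc.
have nU : \forall x' \near x, forall y, F (x', y) -> [set y | flip s y < c'] y.
  apply: usc_near => //; last by move=> y /xsectionP/Fxc'.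
  apply: (@open_comp _ _ (flip s) [set z | z < c']); last exact: open_lt.
  by move=> ? _; exact: flip_cont.
have [M FM] := cusco_bounded cX cF.
have eta0 : 0 < c - c' by lra.
have [j [jx jU]] := h_peak (c' - M) nU eta0; exists j.
apply: (@le_lt_trans _ _ c'); last by lra.
apply: top_height_le => // -[x' y] Fp; rewrite /height /=.
have [Ux'|/jU nUx'] :=
  pselect (forall y, F (x', y) -> [set y | flip s y < c'] y).
  by have := Ux' y Fp; have := h_le0 j x'; rewrite /=; lra.
by have := FM _ Fp; have := ler_flip s y; rewrite /=; lra.
Qed.

(** A value outside the interval [F(x)] lies strictly above or strictly below it,
and is then excluded by a function peaking at [x]. *)
Lemma hull_top_height F : cusco F -> hull (fun s j => top_height s j F) = F.
Proof.
move=> cF; apply/seteqP; split=> [[x y] Fxy|p Fp s j]; last exact: height_le_top.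
apply: contrapT => nFxy; have [_ /(_ x)[_ _ cvx]] := cF.
have [|s Fs] := @convex_separation R (xsection F x) y cvx.
  by move=> /xsectionP.
have [|j] := @peak_top_height F s x (flip s y) cF.
  by move=> z /xsectionP/Fs.
by have := Fxy s j; rewrite /height /=; lra.
Qed.

(** The compactness argument behind both the description of the topology of
[MC R X] and the convergence of sequences in it. The function [h j0 = 0] bounds
the hulls, so only a compact part of the complement of [W] matters; each of its
points violates one strict inequality, which persists nearby and for close
right-hand sides. *)
Lemma near_hull T (Fi : set_system T) pi (pi_ : T -> bool -> J -> R) W :
  Filter Fi -> (forall s j, pi_ t s j @[t --> Fi] --> pi s j) ->
  open W -> hull pi `<=` W -> \forall t \near Fi, hull (pi_ t) `<=` W.
Proof.
move=> FFi pi_pi oW piW.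
pose c := `|pi true j0| + `|pi false j0| + 1.
have pic s : pi s j0 < c.
  have := ler_norm (pi true j0); have := ler_norm (pi false j0).
  have := normr_ge0 (pi true j0); have := normr_ge0 (pi false j0).
  by rewrite /c; case: s; lra.
have nc s : \forall t \near Fi, pi_ t s j0 < c.
  exact: (pi_pi s j0 _ (lt_nbhsl (pic s))).
pose K := ([set: X] `*` `[- c, c]) `&` ~` W.
have cK : near_covering K.
  apply/compact_near_coveringP; apply: compact_closedI; last exact: open_closedC.
  by apply: compact_setX => //; exact: segment_compact.
have : \forall t \near Fi, K `<=` fun p => ~ hull (pi_ t) p.
  apply: cK => p [_ nWp].
  have : ~ hull pi p by move/piW.
  move=> /existsNP[s /existsNP[j /negP]]; rewrite -ltNge => pip.
  pose m := (pi s j + height s j p) / 2.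
  have pm : nbhs p [set q | m < height s j q].
    apply: (@height_cont s j p [set z | m < z]).
    by apply: lt_nbhsr; rewrite /m; lra.
  have tm : \forall t \near Fi, pi_ t s j < m.
    by apply: (pi_pi s j [set z | z < m]); apply: lt_nbhsl; rewrite /m; lra.
  exists ([set q | m < height s j q], [set t | pi_ t s j < m]) => //.
  by move=> [q t] /= [mq tm'] /(_ s j); lra.
apply: filterS3 (nc true) (nc false) => t tc fc Kt p tp.
apply: contrapT => nWp; apply: (Kt p) => //; split => //; split => //=.
have := tp true j0; have := tp false j0; rewrite /height !h_j0 /flip in_itv /=.
by move=> ? ?; apply/andP; split; lra.
Qed.

Lemma MC_cusco (F : MC R X) : cusco (sval F).
Proof. by have [] := svalP F. Qed.

(** Upper semicontinuity is immediate for the upper Vietoris topology. Lower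
semicontinuity rests on minimality: near an almost highest point there is a whole
fibre of almost maximal height, and the maps avoiding the low part of that single
fibre form an open set. *)
Lemma top_height_cont s j : continuous (fun F : MC R X => top_height s j (sval F)).
Proof.
move=> F; have FF := nbhs_filter F.
apply/(@cvgrPdist_le _ _ _ (nbhs F)) => e e0.
have cF := MC_cusco F; pose S := top_height s j (sval F).
have upper : \forall G \near F, top_height s j (sval G) <= S + e.
  apply/nbhs_upper_vietoris; exists [set p | height s j p < S + e]; split.
  - apply: (@open_comp _ _ (height s j) [set z | z < S + e]); last exact: open_lt.
    by move=> ? _; exact: height_cont.
  - by move=> p Fp /=; have := height_le_top s j cF Fp; rewrite /S; lra.
  - move=> G GW; apply: top_height_le; first exact: MC_cusco.
    by move=> p /GW/ltW.
have lower : \forall G \near F, S - e <= top_height s j (sval G).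
  have [||[x y] Fxy xyS] := @top_height_gt s j (sval F) (S - e / 2) => //.
    by rewrite /S; lra.
  have hx : nbhs x [set x' | `|h j x - h j x'| < e / 4].
    by have /cvgrPdist_lt := @h_cont j x; apply; lra.
  have [|x' x'h Fx'] := minimal_cusco_localizes (s := s)
    (c := flip s y - e / 4) (svalP F) Fxy hx.
    by lra.
  apply/nbhs_upper_vietoris.
  exists [set p | p.1 = x' -> flip s y - e / 4 < flip s p.2]; split.
  - apply: (open_over_point
      (V := flip s @^-1` [set z | flip s y - e / 4 < z])) => //.
    by apply: open_comp; [move=> ? _; exact: flip_cont|exact: open_gt].
  - by move=> [a b] Fab /= ax'; apply: Fx'; rewrite -ax'.
  - move=> G GW; have [b Gb] := cusco_nonempty x' (MC_cusco G).
    apply: le_trans (height_le_top s j (MC_cusco G) Gb).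
    have /(_ erefl) /= := GW _ Gb; move: x'h xyS; rewrite /height /= ltr_distlC.
    by move=> /andP[]; lra.
by apply: filterS2 upper lower => G; rewrite -/S ler_distlC => -> ->.
Qed.

(** The topology of [MC R X] is the initial one for the [top_height s j]. *)
Lemma top_height_cvg (Fi : set_system (MC R X)) (F : MC R X) : Filter Fi ->
  (forall s j,
    top_height s j (sval G) @[G --> Fi] --> top_height s j (sval F)) ->
  Fi --> F.
Proof.
move=> FFi S_cvg U /nbhs_upper_vietoris[W [oW FW WU]].
have := near_hull FFi S_cvg oW; rewrite (hull_top_height (MC_cusco F)) => /(_ FW).
by apply: filterS => G; rewrite (hull_top_height (MC_cusco G)) => /WU.
Qed.

Lemma top_height_inj (F G : MC R X) :
  (forall s j, top_height s j (sval F) = top_height s j (sval G)) -> F = G.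
Proof.
move=> FG; apply: (eq_sig_hprop (fun _ _ _ => Prop_irrelevance _ _)).
rewrite -(hull_top_height (MC_cusco F)) -(hull_top_height (MC_cusco G)).
by congr hull; apply/funext => s; apply/funext => j.
Qed.

(** The supremum of [h j + h j'] minus [top_height (~~ s) j' F] is a lower bound
of [top_height s j F] that is computed from the opposite boundary of [F] alone. The
gap is positive when this bound is sharp up to 1/(n+1). Having for all (s, j, n)
some [j'] with a positive gap means that each boundary is determined by the other,
as for minimal maps. *)
Definition gap (k : bool * J * nat) (j' : J) (F : MC R X) : R :=
  let: (s, j, n) := k in
  sup (range (fun x => h j x + h j' x)) - top_height (~~ s) j' (sval F)
  - top_height s j (sval F) + n.+1%:R^-1.

Lemma gap_cont k j' : continuous (gap k j').
Proof.
case: k => [[s j] n] F; have FF := nbhs_filter F; rewrite /gap.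
apply: cvgD; last exact: cvg_cst.
apply: cvgB; last exact: (@top_height_cont s j F).
by apply: cvgB; [exact: cvg_cst|exact: (@top_height_cont (~~ s) j' F)].
Qed.

Lemma le_sup_heights j j' x :
  h j x + h j' x <= sup (range (fun x => h j x + h j' x)).
Proof.
apply: ub_le_sup; last by exists x.
by exists 0 => _ [y _ <-]; have := h_le0 j y; have := h_le0 j' y; lra.
Qed.

(** By minimality some fibre is almost as high as possible throughout; a function
[h j'] peaking at its base point witnesses this from the opposite side. *)
Lemma gap_gt0 k (F : MC R X) : exists j', 0 < gap k j' F.
Proof.
case: k => [[s j] n] /=; pose e : R := n.+1%:R^-1.
have e0 : 0 < e by rewrite invr_gt0 ltr0n.
pose S := top_height s j (sval F).
have [|[x y] Fxy xyS] :=
  @top_height_gt s j (sval F) (S - e / 4) (MC_cusco F).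
  by rewrite /S; lra.
have hx : nbhs x [set x' | `|h j x - h j x'| < e / 4].
  by have /cvgrPdist_lt := @h_cont j x; apply; lra.
have [|x' x'h Fx'] := minimal_cusco_localizes (s := s)
  (c := flip s y - e / 4) (svalP F) Fxy hx.
  by lra.
have [|j' j'P] := @peak_top_height (sval F) (~~ s) x'
  (- (flip s y - e / 4)) (MC_cusco F).
  by move=> z /Fx'; case: (s) => /=; lra.
exists j'; rewrite -/S -/e; have := le_sup_heights j j' x'.
move: x'h xyS; rewrite /height /= ltr_distlC => /andP[].
by lra.
Qed.

Lemma closed_hull pi : closed (hull pi).
Proof.
rewrite (_ : hull pi = \bigcap_(k in [set: bool * J])
    (height k.1 k.2 @^-1` [set z | z <= pi k.1 k.2])).
  apply: closed_bigI => k _; apply: closed_comp; last exact: closed_le.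
  by move=> ? _; exact: height_cont.
by apply/seteqP; split=> [p pip [s j] _|p pip s j];
  [exact: pip|exact: (pip (s, j))].
Qed.

(** Closed graph and uniformly bounded values give upper semicontinuity. *)
Lemma hull_cusco pi : (forall x, exists y, hull pi (x, y)) -> cusco (hull pi).
Proof.
move=> pi_ne.
pose c := `|pi true j0| + `|pi false j0|.
have pic p : hull pi p -> p.2 \in `[- c, c].
  move=> pip; have := pip true j0; have := pip false j0.
  rewrite /height !h_j0 in_itv /=.
  have := ler_norm (pi true j0); have := ler_norm (pi false j0).
  have := normr_ge0 (pi true j0); have := normr_ge0 (pi false j0).
  by rewrite /c => ? ? ? ? ? ?; apply/andP; split; lra.
have cxs x : closed (xsection (hull pi) x).
  rewrite (_ : xsection _ x = (fun y => (x, y)) @^-1` hull pi); last first.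
    by apply/seteqP; split=> y /xsectionP.
  apply: closed_comp; last exact: closed_hull.
  move=> y _.
  exact: (cvg_pair (G := nbhs x) (H := nbhs y) (cvg_cst x) cvg_id).
split=> [x V oV piV|x]; last first.
  split.
  - by have [y xy] := pi_ne x; exists y; apply/xsectionP.
  - apply: subclosed_compact (cxs x) (@segment_compact _ (- c) c) _.
    by move=> y /xsectionP/pic.
  - move=> a b t; rewrite !inE => /xsectionP pa /xsectionP pb.
    apply/xsectionP => s j.
    have := pa s j; have := pb s j; rewrite /height /= -!lerBrDr => ? ?.
    exact: flip_conv_le.
have cK : near_covering (`[- c, c] `&` ~` V).
  apply/compact_near_coveringP; apply: compact_closedI; last exact: open_closedC.
  exact: segment_compact.
have : \forall x' \near x,
    (`[- c, c] `&` ~` V) `<=` fun y => ~ hull pi (x', y).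
  apply: cK => y [_ nVy].
  have nxy : ~ hull pi (x, y) by move=> xy; apply: nVy; apply: piV; apply/xsectionP.
  have [[A B] /= [xA yB] AB] : nbhs (x, y) (~` hull pi).
    by apply: open_nbhs_nbhs; split => //; exact/closed_openC/closed_hull.
  by exists (B, A) => //= -[y' x'] /= [By' Ax']; exact: (AB (x', y')).
apply: filterS => x' Kx' y /xsectionP x'y; apply: contrapT => nVy.
by apply: (Kx' y) => //; split => //; exact: (pic (x', y)).
Qed.

Section Limit.
Variables (u : nat -> MC R X) (pi : bool -> J -> R).
Hypothesis u_pi : forall s j, top_height s j (sval (u n)) @[n --> \oo] --> pi s j.
Hypothesis u_gap : forall k, exists n, forall m,
  exists2 j', (pickle j' < n)%N & 0 < gap k j' (u m).

(** The upper and the lower constraints at a point are compatible, since they are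
limits of constraints satisfied by the values of the [u n]; the supremum of the
lower ones then satisfies them all. *)
Lemma limit_hull_nonempty x : exists y, hull pi (x, y).
Proof.
have compat j j' : h j' x - pi false j' <= pi true j - h j x.
  have : (top_height true j (sval (u n)) + top_height false j' (sval (u n)))
     @[n --> \oo] --> pi true j + pi false j' by exact: cvgD.
  have ge_hh : \forall n \near \oo, h j x + h j' x <=
      top_height true j (sval (u n)) + top_height false j' (sval (u n)).
    apply: nearW => n; have cu := MC_cusco (u n).
    have [y uxy] := cusco_nonempty x cu.
    have := height_le_top true j cu uxy.
    have := height_le_top false j' cu uxy.
    by rewrite /height /=; lra.
  by move=> /cvgr_to_ge/(_ ge_hh); lra.
pose E := range (fun j => h j x - pi false j).
have E0 : E !=set0 by exists (h j0 x - pi false j0), j0.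
have Eub j : ubound E (pi true j - h j x) by move=> _ [j' _ <-]; exact: compat.
exists (sup E) => -[] j; rewrite /height /=.
  by rewrite -lerBrDr; apply: ge_sup.
have : h j x - pi false j <= sup E.
  by apply: ub_le_sup; [exists (pi true j0 - h j0 x); exact: Eub|exists j].
by lra.
Qed.

(** If a cusco map [G] inside the hull missed one of its points, some
[top_height s j G] would be below [pi s j] by a definite amount. The opposite heights
of [G] are at most [pi (~~ s)], so the lower bounds computed from [pi (~~ s)] do not
exceed [top_height s j G] either. They all fall short of [pi s j] by that amount,
which makes the relevant gaps of the [u m] eventually negative. *)
Lemma limit_minimal_cusco : minimal_cusco (hull pi).
Proof.
split; first exact: hull_cusco limit_hull_nonempty.
move=> G cG Gpi; apply/seteqP; split => // -[x y] xy; apply: contrapT => nGxy.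
have [_ /(_ x)[_ _ cvx]] := cG.
have [|s Gs] := @convex_separation R (xsection G x) y cvx.
  by move=> /xsectionP.
have [|j Gj] := @peak_top_height G s x (flip s y) cG.
  by move=> z /xsectionP/Gs.
have xypi := xy s j; rewrite /height /= in xypi.
pose S := top_height s j G.
have Spi : S < pi s j by rewrite /S; lra.
have bad j' : sup (range (fun x => h j x + h j' x)) - pi (~~ s) j' <= S.
  rewrite lerBlDr; apply: ge_sup; first by exists (h j x0 + h j' x0), x0.
  move=> _ [x' _ <-]; have [y' Gy'] := cusco_nonempty x' cG.
  have := Gpi _ Gy' (~~ s) j'; have := height_le_top s j cG Gy'.
  by rewrite /height /= -/S; case: (s) => /=; lra.
(* Three errors, from the two limits and from the term 1/(N+1) of the gap. *)
pose e := (pi s j - S) / 4; have e0 : 0 < e by rewrite /e; lra.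
pose N := Num.trunc e^-1.
have Ne : N.+1%:R^-1 < e.
  by rewrite invf_plt ?posrE // truncnS_gt.
have [n un] := u_gap (s, j, N).
have far : \forall m \near \oo, forall j', (pickle j' < n)%N ->
    gap (s, j, N) j' (u m) < 0.
  apply: near_pickle_lt => j'.
  have c1 : \forall m \near \oo,
      pi (~~ s) j' - e < top_height (~~ s) j' (sval (u m)).
    apply: (@u_pi (~~ s) j' [set z | pi (~~ s) j' - e < z]).
    by apply: lt_nbhsr; lra.
  have c2 : \forall m \near \oo, pi s j - e < top_height s j (sval (u m)).
    by apply: (@u_pi s j [set z | pi s j - e < z]); apply: lt_nbhsr; lra.
  apply: filterS2 c1 c2 => m c1m c2m; rewrite /gap.
  have ee : 4 * e = pi s j - S by rewrite /e; lra.
  have badj := bad j'.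
  move: Ne; set iN := N.+1%:R^-1 => Ne; lra.
have [m /(_ _)far_m] := filter_ex far.
have [j' j'n] := un m.
by have := far_m j' j'n; lra.
Qed.

Lemma limit_exists : exists F : MC R X, u @ \oo --> F.
Proof.
exists (exist _ _ limit_minimal_cusco) => U /nbhs_upper_vietoris[W [oW /= piW WU]].
have nW : \forall n \near \oo,
    hull (fun s j => top_height s j (sval (u n))) `<=` W.
  exact: near_hull piW.
apply: filterS nW => n; rewrite (hull_top_height (MC_cusco (u n))); exact: WU.
Qed.
End Limit.

Lemma polish_MC : polish_space R (MC R X).
Proof.
apply: (@trapped_polish R (MC R X)
  (bool * J)%type J (bool * J * nat)%type
  (fun k (F : MC R X) => top_height k.1 k.2 (sval F)) gap).
- by move=> k; exact: top_height_cont.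
- by move=> F Fi FFi S_cvg; apply: top_height_cvg => s j; exact: (S_cvg (s, j)).
- by move=> F G FG; apply: top_height_inj => s j; exact: (FG (s, j)).
- by move=> k j'; exact: gap_cont.
- exact: gap_gt0.
- move=> u u_cvg u_gap.
  apply: (@limit_exists u
    (fun s j => lim (top_height s j (sval (u n)) @[n --> \oo]))) => //.
  by move=> s j; exact: (u_cvg (s, j)).
Qed.

End TopHeights.

(** * Peaking functions on a compact metric space *)

Section Peaks.
Variables (R : realType) (X : topologicalType) (d : X -> X -> R) (x0 : X).
Hypothesis d_metric : is_metric d.
Hypothesis d_top : induces_topology d.
Hypothesis cX : compact [set: X].

Lemma open_dist_ball x e : open [set y | d x y < e].
Proof.
have [d0 _ _ dT] := d_metric.
apply/d_top => y /= xy; exists (e - d x y); first by lra.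
by move=> z /= yz; have := dT x y z; lra.
Qed.

Lemma nbhs_dist_ball x e : 0 < e -> nbhs x [set y | d x y < e].
Proof.
move=> e0; apply: open_nbhs_nbhs; split; first exact: open_dist_ball.
by have [_ d0 _ _] := d_metric; rewrite /= (d0 x x).2.
Qed.

Lemma dist_cont q : continuous (d^~ q).
Proof.
have [d0 _ dC dT] := d_metric.
move=> x; apply/cvgrPdist_lt => e e0.
apply: filterS (nbhs_dist_ball x e0) => y /= xy.
have := dT x y q; have := dT y x q; rewrite (dC y x) ltr_distl => ? ?.
by apply/andP; split; lra.
Qed.

(** Near covering applied to the filter of all large enough finite lists. *)
Lemma finite_net e : 0 < e ->
  exists s : seq X, forall x, exists2 q, q \in s & d x q < e.
Proof.
have [_ d0 dC _] := d_metric; move=> e0.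
pose Fi := filter_from [set: seq X] (fun s => [set s' : seq X | {subset s <= s'}]).
have FFi : Filter Fi.
  apply: filter_from_filter; first by exists [::].
  move=> s s' _ _; exists (s ++ s') => // s'' /= ss'.
  by split=> x xs; apply: ss'; rewrite mem_cat xs ?orbT.
have : \forall s \near Fi, [set: X] `<=` fun x => exists2 q, q \in s & d x q < e.
  have /compact_near_coveringP ncX := cX; apply: ncX => x _.
  exists ([set y | d x y < e], [set s : seq X | x \in s]).
    split; first exact: nbhs_dist_ball.
    by exists [:: x] => // s /= xs; apply: xs; rewrite mem_head.
  by move=> [y s] /= [xy xs]; exists x => //; rewrite dC.
by move=> [s _ sP]; exists s => x; exact: sP.
Qed.

Lemma countable_dense : exists q : nat * nat -> X,
  forall x e, 0 < e -> exists k, d x (q k) < e.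
Proof.
have /choice[s sP] : forall n : nat, exists s : seq X,
    forall x, exists2 q, q \in s & d x q < n.+1%:R^-1.
  by move=> n; apply: finite_net; rewrite invr_gt0 ltr0n.
exists (fun k => nth x0 (s k.1) k.2) => x e e0.
have [q qs xq] := sP (Num.trunc e^-1) x.
exists (Num.trunc e^-1, index q (s (Num.trunc e^-1))); rewrite /= nth_index //.
apply: lt_trans xq _.
by rewrite invf_plt ?posrE ?ltr0n // truncnS_gt.
Qed.

(** The functions - k * d (., q), with [k] an integer and [q] in a dense
sequence. *)
Lemma peaking_family : exists h : nat * (nat * nat) -> X -> R,
  [/\ forall j, continuous (h j), forall j x, h j x <= 0,
      forall x, h (0, (0, 0))%N x = 0
    & forall x U (B eta : R), nbhs x U -> 0 < eta ->
      exists j, - eta < h j x /\ forall x', ~ U x' -> h j x' < B].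
Proof.
have [d0 dE dC dT] := d_metric; have [q q_dense] := countable_dense.
exists (fun j x => - (j.1%:R * d x (q j.2))); split.
- move=> j x; apply: cvgN; apply: cvgM; first exact: cvg_cst.
  exact: dist_cont.
- by move=> j x; rewrite oppr_le0 mulr_ge0 ?ler0n.
- by move=> x; rewrite mul0r oppr0.
move=> x U B eta; rewrite nbhsE => -[V [oV Vx] VU] eta0.
have [e e0 eV] := (d_top V).1 oV x Vx.
pose k := (Num.trunc (`|B| / (e / 2))).+1.
have k0 : 0 < k%:R :> R by rewrite ltr0n.
have kB : `|B| < k%:R * (e / 2).
  by rewrite -ltr_pdivrMr ?truncnS_gt //; lra.
have m0 : 0 < Num.min (e / 2) (eta / k%:R).
  by rewrite lt_min !divr_gt0.
have [i] := q_dense x _ m0; rewrite lt_min => /andP[xi_e].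
rewrite ltr_pdivlMr // mulrC => xi_eta.
exists (k, i); split=> /=; first by rewrite ltrN2.
move=> x' nUx'; have ex' : e <= d x x'.
  by rewrite leNgt; apply/negP => /eV/VU.
have : e / 2 <= d x' (q i) by have := dT x (q i) x'; rewrite (dC (q i)); lra.
move=> /(ler_wpM2l (ltW k0)); have := ler_norm (- B); rewrite normrN; lra.
Qed.

End Peaks.

(** * The characterization *)

Theorem theorem5p13 (R : realType) (X : topologicalType)
  (X0 : [set: X] !=set0) (tychX : tychonoff_space X) :
  polish_space R (MC R X) <-> compact [set: X] /\ metrizable R X.
Proof.
have [hX crX] := tychX; split=> [[sc _]|[cX [d [d_metric d_top]]]].
  split; first exact: compact_of_second_countable_MC hX crX sc.
  exact: metrizable_of_second_countable_MC hX crX sc.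
have [x0 _] := X0.
have [h [h_cont h_le0 h_0 h_peak]] := peaking_family x0 d_metric d_top cX.
exact: (polish_MC x0 hX cX h_cont h_le0 h_0 h_peak).
Qed.
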